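(* Let $f=[f_1,\ldots,f_n]^\top\in\mathbb{C}[X_1,\ldots,X_n]^n$ be a square polynomial system, let $\xi\in\mathbb{C}^n$ be an isolated singular zero of $f$, and let $\kappa=\dim\ker Df(\xi)\ge 1$. Let $V=[V_1,V_2]\in\mathbb{C}^{n\times n}$ be an invertible matrix with $V_1\in\mathbb{C}^{n\times(n-\kappa)}$, $\operatorname{im}V_1=(\ker Df(\xi))^{\perp}$, and $V_2\in\mathbb{C}^{n\times\kappa}$, $\operatorname{im}V_2=\ker Df(\xi)$. For $\boldsymbol{\lambda}_2\in\mathbb{C}^{\kappa}$ put $$Dg(\xi,0)=\begin{bmatrix} Df(\xi) & \mathbf{0}\\ D^2f(\xi)\cdot V_2\cdot\boldsymbol{\lambda}_2 & Df(\xi)\cdot V_1\end{bmatrix}\in\mathbb{C}^{2n\times(2n-\kappa)}.$$ Then $Dg(\xi,0)$ is of full column rank for almost all choices of $\boldsymbol{\lambda}_2\in\mathbb{C}^{\kappa}$ (that is, $\xi$ is a deflation-one singular zero of $f$) if and only if the linear operator $$\mathcal{A}(\xi)=Df(\xi)+D^2f(\xi)\bigl(v,\Pi_{\ker Df(\xi)}\,\cdot\,\bigr):\mathbb{C}^n\to\mathbb{C}^n$$ is invertible for almost all choices of $v\in\ker Df(\xi)$.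
   Context: $Df(\xi)$ is the $n\times n$ Jacobian matrix of $f$ at $\xi$, and $D^2f(\xi)$ is the $n\times n\times n$ tensor of second-order partial derivatives, viewed as a symmetric bilinear map $\mathbb{C}^n\times\mathbb{C}^n\to\mathbb{C}^n$ with $i$-th component $D^2f(\xi)(u,w)_i=\sum_{j,k}\frac{\partial^2 f_i}{\partial X_j\partial X_k}(\xi)u_jw_k$. For a vector $u$, $D^2f(\xi)\cdot u$ is the $n\times n$ matrix of the linear map $w\mapsto D^2f(\xi)(u,w)$. $\Pi_{\ker Df(\xi)}$ is the Hermitian (orthogonal) projection of $\mathbb{C}^n$ onto $\ker Df(\xi)$, so $\mathcal{A}(\xi)w=Df(\xi)w+D^2f(\xi)(v,\Pi_{\ker Df(\xi)}w)$. $\xi$ is an isolated singular zero of $f$ if $f(\xi)=0$, there is $r>0$ such that $\xi$ is the only zero of $f$ in the ball of radius $r$ about $\xi$, and $\dim\ker Df(\xi)>0$. The matrix $Dg(\xi,0)$ is the Jacobian at $(X,\boldsymbol{\lambda}_1)=(\xi,0)$ of the augmented system $g(X,\boldsymbol{\lambda}_1)=\begin{bmatrix} f\\ Df\cdot(V_1\boldsymbol{\lambda}_1+V_2\boldsymbol{\lambda}_2)\end{bmatrix}$ of $2n$ equations in the $2n-\kappa$ variables $X_1,\ldots,X_n$ and $\boldsymbol{\lambda}_1\in\mathbb{C}^{n-\kappa}$, for fixed $\boldsymbol{\lambda}_2$. An isolated singular zero $\xi$ is called a deflation-one singular zero if $Dg(\xi,0)$ has full column rank for almost all $\boldsymbol{\lambda}_2\in\mathbb{C}^\kappa$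 (one deflation step regularizes it). ''For almost all choices'' means: for all choices outside a proper algebraic subset of the vector space in question ($\mathbb{C}^\kappa$, respectively $\ker Df(\xi)\cong\mathbb{C}^\kappa$). *)

(* Defs.v *)
From HB Require Import structures.
From mathcomp Require Export all_boot all_order all_algebra.
From mathcomp Require Export complex spectral.
From mathcomp Require Export reals.
From mathcomp Require Export mpoly.

Set Implicit Arguments.
Unset Strict Implicit.
Unset Printing Implicit Defensive.

Import Order.TTheory GRing.Theory Num.Theory.
Local Open Scope ring_scope.

(* Points of C^n are column vectors over R[i]; a polynomial system is a column
   vector of multivariate polynomials. *)
Section Defs.
Variable R : realType.
Local Notation C := R[i].

Definition hdot n (u w : 'cV[C]_n) : C := \sum_i u i 0 * (w i 0)^*.
Definition hnorm n (u : 'cV[C]_n) : C := sqrtC (hdot u u).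

Definition im_mx m n (A : 'M[C]_(m, n)) : {vspace 'cV[C]_m} :=
  limg (linfun (mulmx A : 'cV[C]_n -> 'cV[C]_m)).
Definition ker_mx m n (A : 'M[C]_(m, n)) : {vspace 'cV[C]_n} :=
  lker (linfun (mulmx A : 'cV[C]_n -> 'cV[C]_m)).

Definition full_column_rank m n (A : 'M[C]_(m, n)) : Prop := \rank A = n.

(* [proj_ortho U] projects row vectors orthogonally, for the Hermitian product,
   onto the row space of U, and the row space of [kermx A^T] consists of the
   transposes of the w such that [A *m w = 0]; hence the two transpositions. *)
Definition proj_ker n (A : 'M[C]_n) : 'M[C]_n := (proj_ortho (kermx A^T))^T.

Definition zero_locus n (S : {mpoly C[n]} -> Prop) (x : 'cV[C]_n) : Prop :=
  forall p, S p -> p.@[fun i => x i 0] = 0.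

(* The algebraic subsets of a linear subspace L of C^n are the traces on L of
   the algebraic subsets of C^n. *)
Definition almost_all n (L : {vspace 'cV[C]_n}) (P : 'cV[C]_n -> Prop) : Prop :=
  exists S : {mpoly C[n]} -> Prop,
    (exists2 x, x \in L & ~ zero_locus S x) /\
    (forall x, x \in L -> ~ zero_locus S x -> P x).

Definition eval_sys m n (f : 'cV[{mpoly C[n]}]_m) (x : 'cV[C]_n) : 'cV[C]_m :=
  \col_i (f i 0).@[fun j => x j 0].

Definition jacobian m n (f : 'cV[{mpoly C[n]}]_m) : 'M[{mpoly C[n]}]_(m, n) :=
  \matrix_(i, j) (f i 0)^`M(j).

Definition jacobian_at m n (f : 'cV[{mpoly C[n]}]_m) (x : 'cV[C]_n) :
    'M[C]_(m, n) :=
  map_mx (meval (fun j => x j 0)) (jacobian f).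

Definition hessian_at m n (f : 'cV[{mpoly C[n]}]_m) (x u w : 'cV[C]_n) :
    'cV[C]_m :=
  \col_i \sum_j \sum_k
    ((f i 0)^`M(j))^`M(k).@[fun l => x l 0] * u j 0 * w k 0.

(* The matrix of w |-> D^2 f(x)(u, w). *)
Definition hessian_mx m n (f : 'cV[{mpoly C[n]}]_m) (x u : 'cV[C]_n) :
    'M[C]_(m, n) :=
  \matrix_(i, k) hessian_at f x u (delta_mx k 0) i 0.

Definition isolated_singular_zero n (f : 'cV[{mpoly C[n]}]_n) (xi : 'cV[C]_n) :
    Prop :=
  [/\ eval_sys f xi = 0,
      exists2 r : R, 0 < r &
        forall x, hnorm (x - xi) < (r%:C)%C -> eval_sys f x = 0 -> x = xi
    & (0 < \dim (ker_mx (jacobian_at f xi)))%N].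

(* In C[X, lambda_1], the variables X_1, ..., X_n come first. *)
Definition lift_poly n k (p : {mpoly C[n]}) : {mpoly C[n + k]} :=
  p \mPo [tuple 'X_(lshift k j) | j < n].

Definition augmented n kappa (f : 'cV[{mpoly C[n]}]_n)
    (V1 : 'M[C]_(n, n - kappa)) (V2 : 'M[C]_(n, kappa)) (lam2 : 'cV[C]_kappa) :
    'cV[{mpoly C[n + (n - kappa)]}]_(n + n) :=
  let lam1 : 'cV_(n - kappa) := \col_j 'X_(rshift n j) in
  col_mx (map_mx (@lift_poly n (n - kappa)) f)
         (map_mx (@lift_poly n (n - kappa)) (jacobian f) *m
          (map_mx (@mpolyC _ _) V1 *m lam1 + map_mx (@mpolyC _ _) (V2 *m lam2))).

Definition Dg n kappa (f : 'cV[{mpoly C[n]}]_n) (xi : 'cV[C]_n)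
    (V1 : 'M[C]_(n, n - kappa)) (V2 : 'M[C]_(n, kappa)) (lam2 : 'cV[C]_kappa) :
    'M[C]_(n + n, n + (n - kappa)) :=
  jacobian_at (augmented f V1 V2 lam2) (col_mx xi 0).

Definition deflation_one n kappa (f : 'cV[{mpoly C[n]}]_n) (xi : 'cV[C]_n)
    (V1 : 'M[C]_(n, n - kappa)) (V2 : 'M[C]_(n, kappa)) : Prop :=
  isolated_singular_zero f xi /\
  almost_all fullv (fun lam2 => full_column_rank (Dg f xi V1 V2 lam2)).

Definition opA n (f : 'cV[{mpoly C[n]}]_n) (xi v w : 'cV[C]_n) : 'cV[C]_n :=
  jacobian_at f xi *m w +
  hessian_at f xi v (proj_ker (jacobian_at f xi) *m w).

End Defs.

(* Main.v *)
Require Import Defs.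

(** Fix [v = V2 *m lam2], let [J] be the Jacobian at [xi], [H] the matrix of
    [D^2 f(xi)(v, .)] and [P] the orthogonal projection onto [ker J].  The two
    full-rank conditions agree for each single [v]: because [im V1] is the
    orthogonal complement of [ker J] and [V1] is injective, [w = u + V1 *m l]
    is a bijective change of variables between vectors [w] and pairs [(u, l)]
    with [J *m u = 0], in which [u = P *m w].  Under it the second block row of
    [Dg] applied to [(u, l)], namely [H *m u + J *m V1 *m l], becomes
    [J *m w + H *m P *m w], which is the operator applied to [w]; the first
    block row of [Dg] is the constraint [J *m u = 0].  So one kernel is trivial
    if and only if the other is ([block_full_column_rank]).

    Passing from each [v] to almost all [v] uses that [V2] is a linear
    isomorphism of [C^kappa] onto [ker J] whose inverse is the restriction of a
    matrix: composing polynomials with a matrix pulls algebraic subsets back to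
    algebraic subsets, and a surjection keeps the pulled back subset proper
    ([almost_all_pullback]).

    In the block form of [Dg], a row of the second block is a sum of products of
    a lifted derivative of [f] and an affine form in [lambda_1] that is
    constant in [X].  Differentiating in [X] hits the first factor and leaves
    the affine form, whose value at [lambda_1 = 0] is an entry of
    [V2 *m lam2]; differentiating in [lambda_1] hits the affine form and yields
    an entry of [V1]. *)

Set Implicit Arguments.
Unset Strict Implicit.
Unset Printing Implicit Defensive.

Import Order.TTheory GRing.Theory Num.Theory.
Local Open Scope ring_scope.

Section Deflation.
Variable R : realType.
Local Notation C := R[i].

(** * Kernels, images and the orthogonal projection *)

Lemma mem_ker_mx m n (A : 'M[C]_(m, n)) w : (w \in ker_mx A) = (A *m w == 0).
Proof. by rewrite memv_ker lfunE. Qed.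

Lemma mem_im_mxP m n (A : 'M[C]_(m, n)) w :
  w \in im_mx A <-> exists x, w = A *m x.
Proof.
split=> [/memv_imgP[x _ ->]|[x ->]]; first by exists x; rewrite lfunE.
by rewrite -[A *m x](lfunE (mulmx A)) memv_img ?memvf.
Qed.

Lemma full_column_rankP m n (A : 'M[C]_(m, n)) :
  full_column_rank A <-> (forall x : 'cV_n, A *m x = 0 -> x = 0).
Proof.
split=> [/eqP/row_fullP[B BA] x Ax0|injA].
  by rewrite -[x]mul1mx -BA -mulmxA Ax0 mulmx0.
apply/eqP; rewrite -mxrank_tr -/(row_free A^T) -kermx_eq0.
apply/eqP/row_matrixP=> i; rewrite row0.
apply: trmx_inj; rewrite trmx0; apply: injA.
by apply: trmx_inj; rewrite trmx_mul trmxK -row_mul mulmx_ker row0 trmx0.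
Qed.

Lemma bijective_mulmxP n (A : 'M[C]_n) :
  bijective (mulmx A : 'cV_n -> 'cV_n) <-> full_column_rank A.
Proof.
split=> [[B AK _]|rA].
  by apply/full_column_rankP=> x Ax0; apply: (can_inj AK); rewrite Ax0 mulmx0.
have uA : A \in unitmx by rewrite -row_free_unit /row_free rA.
by exists (mulmx (invmx A)) => x; rewrite ?mulKmx ?mulKVmx.
Qed.

Lemma row_full_castmx_cols m n n' (e : n = n') (A : 'M[C]_(m, n)) :
  row_full (castmx (erefl m, e) A) = row_full A.
Proof. by case: n' / e; rewrite castmx_id. Qed.

Lemma hdotE n (u w : 'cV[C]_n) :
  hdot u w = (u^T *m map_mx Num.conj w) 0 0.
Proof. by rewrite mxE; apply: eq_bigr => i _; rewrite !mxE. Qed.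

Section Projection.
Variables (n : nat) (J : 'M[C]_n).

Lemma mulmx_proj_ker (w : 'cV[C]_n) :
  proj_ker J *m w = (w^T *m proj_ortho (kermx J^T))^T.
Proof. by rewrite trmx_mul trmxK. Qed.

Lemma proj_ker_mem (w : 'cV[C]_n) : J *m (proj_ker J *m w) = 0.
Proof.
apply: trmx_inj; rewrite trmx0 mulmx_proj_ker trmx_mul trmxK.
exact/sub_kermxP/proj_ortho_sub.
Qed.

Lemma proj_ker_id (w : 'cV[C]_n) : J *m w = 0 -> proj_ker J *m w = w.
Proof.
move=> Jw; rewrite mulmx_proj_ker proj_ortho_id ?trmxK //.
by apply/sub_kermxP; rewrite -trmx_mul Jw trmx0.
Qed.

Lemma proj_ker_ortho (w : 'cV[C]_n) :
  (forall z, J *m z = 0 -> hdot w z = 0) -> proj_ker J *m w = 0.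
Proof.
move=> wK; rewrite mulmx_proj_ker proj_ortho_0 ?trmx0 //.
apply/orthomx1P/rowP=> k; rewrite [RHS]mxE.
have := wK (row k (kermx J^T))^T; rewrite hdotE => <-.
  by rewrite !mxE; apply: eq_bigr => i _; rewrite !mxE.
by apply: trmx_inj; rewrite trmx_mul trmxK -row_mul mulmx_ker row0 trmx0.
Qed.

Lemma proj_ker_compl (w z : 'cV[C]_n) :
  J *m z = 0 -> hdot (w - proj_ker J *m w) z = 0.
Proof.
move=> Jz; have /submxP[c zE] : (z^T <= kermx J^T)%MS.
  by apply/sub_kermxP; rewrite -trmx_mul Jz trmx0.
have /orthomx1P o := proj_ortho_compl_sub (kermx J^T) w^T.
rewrite hdotE -[z]trmxK zE trmx_mul map_mxM mulmxA linearB /=.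
by rewrite mulmx_proj_ker trmxK o mul0mx mxE.
Qed.

(** Kernel vectors [(u, l)] of the block matrix and kernel vectors [w] of
    [J + H *m proj_ker J] correspond by [w = u + V1 *m l], [u] being the
    projection of [w]. *)
Lemma block_full_column_rank k (H : 'M[C]_n) (V1 : 'M[C]_(n, k))
    (injV1 : full_column_rank V1)
    (hV1 : forall w, w \in im_mx V1 <->
                     (forall z, z \in ker_mx J -> hdot w z = 0)) :
  full_column_rank (block_mx J 0 H (J *m V1)) <->
  full_column_rank (J + H *m proj_ker J).
Proof.
have P0 (l : 'cV[C]_k) : proj_ker J *m (V1 *m l) = 0.
  apply: proj_ker_ortho => z Jz.
  have /hV1 : V1 *m l \in im_mx V1 by apply/mem_im_mxP; exists l.
  by apply; rewrite mem_ker_mx Jz eqxx.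
rewrite !full_column_rankP; split=> [injD w|injA x].
  rewrite mulmxDl -mulmxA => Aw0.
  have /mem_im_mxP[l lE] : w - proj_ker J *m w \in im_mx V1.
    by apply/hV1 => z; rewrite mem_ker_mx => /eqP; exact: proj_ker_compl.
  have wE : w = proj_ker J *m w + V1 *m l by rewrite -lE addrC subrK.
  have /eqP : col_mx (proj_ker J *m w) l = 0.
    apply: injD; rewrite mul_block_col mul0mx addr0 proj_ker_mem.
    rewrite -mulmxA -lE mulmxBr proj_ker_mem subr0 addrC Aw0.
    exact: col_mx0.
  by rewrite col_mx_eq0 => /andP[/eqP Pw /eqP l0]; rewrite wE Pw l0 mulmx0 addr0.
rewrite -[x]vsubmxK; set u := usubmx x; set l := dsubmx x.
rewrite mul_block_col mul0mx addr0 => /eqP; rewrite col_mx_eq0.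
case/andP=> /eqP Ju /eqP HJ.
have Pw : proj_ker J *m (u + V1 *m l) = u by rewrite mulmxDr P0 addr0 proj_ker_id.
have w0 : u + V1 *m l = 0.
  by apply: injA; rewrite mulmxDl -mulmxA Pw mulmxDr Ju add0r addrC mulmxA.
have u0 : u = 0 by rewrite -Pw w0 mulmx0.
have l0 : l = 0.
  by move/full_column_rankP: injV1; apply; rewrite -w0 u0 add0r.
by rewrite u0 l0 col_mx0.
Qed.

End Projection.

(** * Almost-all statements along linear maps *)

(** A proper algebraic subset of [L'] pulls back along [A] to an algebraic
    subset of [L]; the section [A'] of [A] provides a point outside of it. *)
Lemma almost_all_pullback m n (L : {vspace 'cV[C]_m}) (L' : {vspace 'cV[C]_n})
    (P : 'cV[C]_m -> Prop) (Q : 'cV[C]_n -> Prop)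
    (A : 'M[C]_(n, m)) (A' : 'M[C]_(m, n))
    (AL : forall x, x \in L -> A *m x \in L')
    (A'L : forall y, y \in L' -> A' *m y \in L)
    (A'K : forall y, y \in L' -> A *m (A' *m y) = y)
    (QP : forall x, x \in L -> Q (A *m x) -> P x) :
  almost_all L' Q -> almost_all L P.
Proof.
case=> S [[y yL' Sy] SQ].
pose lq := [tuple \sum_j A i j *: ('X_j : {mpoly C[m]}) | i < n].
pose S' (p : {mpoly C[m]}) := exists2 q, S q & p = q \mPo lq.
have S'E x : zero_locus S' x <-> zero_locus S (A *m x).
  have ev (q : {mpoly C[n]}) :
      (q \mPo lq).@[fun i => x i 0] = q.@[fun i => (A *m x) i 0].
    rewrite comp_mpoly_meval; apply: meval_eq => i.
    rewrite tnth_mktuple raddf_sum mxE; apply: eq_bigr => j _.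
    by rewrite [LHS]mevalZ mevalXU.
  split=> [Sx q Sq|Sx _ [q Sq ->]]; last by rewrite ev; exact: Sx.
  by rewrite -ev; apply: Sx; exists q.
exists S'; split=> [|x xL /S'E Sx]; last by apply: QP (SQ _ (AL _ xL) Sx).
by exists (A' *m y); [exact: A'L | rewrite S'E A'K].
Qed.

(** * Derivatives of the augmented system *)

Lemma hessian_mxE m n (f : 'cV[{mpoly C[n]}]_m) (x u w : 'cV[C]_n) :
  hessian_at f x u w = hessian_mx f x u *m w.
Proof.
apply/colP=> i; rewrite !mxE exchange_big /=; apply: eq_bigr => k _.
rewrite !mxE mulr_suml; apply: eq_bigr => j _.
rewrite (bigD1 k) //= big1 => [|k' /negPf k'k]; last by rewrite mxE k'k mulr0.
by rewrite mxE !eqxx mulr1 addr0.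
Qed.

(** A polynomial is a sum of monomials and a monomial a product of variables,
    so a property passes to all polynomials from constants and variables. *)
Lemma mpoly_ring_ind (K : comNzRingType) n (P : {mpoly K[n]} -> Prop) :
  (forall c, P c%:MP) -> (forall i, P 'X_i) ->
  (forall p q, P p -> P q -> P (p + q)) ->
  (forall p q, P p -> P q -> P (p * q)) -> forall p, P p.
Proof.
move=> PC PX PD PM; apply: mpolyind => [|c m p _ _ Pp].
  by rewrite -mpolyC0.
apply: PD => //; rewrite -mul_mpolyC; apply: (PM) => //.
rewrite mpolyXE_id; apply: (big_ind P _ PM) => [|i _]; first by rewrite -mpolyC1.
elim: (m i) => [|k IHk]; first by rewrite expr0 -mpolyC1.
by rewrite exprS; apply: PM.
Qed.

Lemma mderivXU (K : nzRingType) l (i j : 'I_l) :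
  ('X_i : {mpoly K[l]})^`M(j) = (i == j)%:R.
Proof.
rewrite mderivX mnm1E; case: eqP => [->|_]; last by rewrite scale0r.
by rewrite -[X in (X - _)%MM]add0m addmK mpolyX0 scale1r.
Qed.

Section Lift.
Variables (n k : nat).
Local Notation lift := (@lift_poly R n k).

Lemma lift_polyX i : lift 'X_i = 'X_(lshift k i).
Proof. by rewrite /lift_poly comp_mpolyXU -tnth_nth tnth_mktuple. Qed.

Lemma lift_polyD p q : lift (p + q) = lift p + lift q.
Proof. exact: comp_mpolyD. Qed.

Lemma lift_polyM p q : lift (p * q) = lift p * lift q.
Proof. exact: rmorphM. Qed.

Lemma mderiv_lift_lshift p j : (lift p)^`M(lshift k j) = lift p^`M(j).
Proof.
elim/mpoly_ring_ind: p => [c|i|p q IHp IHq|p q IHp IHq].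
- by rewrite /lift_poly comp_mpolyC !mderivC comp_mpoly0.
- rewrite lift_polyX !mderivXU (inj_eq (@lshift_inj _ _)).
  by rewrite /lift_poly rmorph_nat.
- rewrite (mderivD j p q) (lift_polyD p q) (lift_polyD p^`M(j)).
  by rewrite -IHp -IHq -mderivD.
- rewrite (mderivM j p q) (lift_polyM p q) lift_polyD.
  by rewrite !lift_polyM -IHp -IHq -mderivM.
Qed.

Lemma mderiv_lift_rshift p j : (lift p)^`M(rshift n j) = 0.
Proof.
elim/mpoly_ring_ind: p => [c|i|p q IHp IHq|p q IHp IHq].
- by rewrite /lift_poly comp_mpolyC mderivC.
- by rewrite lift_polyX mderivXU eq_lrshift.
- by rewrite lift_polyD [LHS]mderivD [X in X + _]IHp [X in _ + X]IHq addr0.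
- by rewrite lift_polyM [LHS]mderivM [X in X * _ + _]IHp [X in _ + _ * X]IHq
     mul0r mulr0 addr0.
Qed.

Lemma meval_lift p (x : 'cV[C]_n) (y : 'cV[C]_k) :
  (lift p).@[fun i => col_mx x y i 0] = p.@[fun i => x i 0].
Proof.
rewrite /lift_poly comp_mpoly_meval; apply: meval_eq => i.
by rewrite tnth_mktuple mevalXU col_mxEu.
Qed.

End Lift.

Lemma jacobian_atE m n (f : 'cV[{mpoly C[n]}]_m) (x : 'cV[C]_n) i j :
  jacobian_at f x i j = ((f i 0)^`M(j)).@[fun l => x l 0].
Proof. by rewrite !mxE. Qed.

Section AffineForm.
Variables (n m : nat) (a : 'I_m -> C) (c : C).

(** The entries of [V1 *m lambda_1 + V2 *m lam2] have this form, the variables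
    [lambda_1] coming after [X_1, ..., X_n]. *)
Definition affine_form : {mpoly C[n + m]} :=
  \sum_j (a j)%:MP * 'X_(rshift n j) + c%:MP.

Lemma mderiv_affine_form i :
  affine_form^`M(i) = \sum_j (a j)%:MP * (rshift n j == i)%:R.
Proof.
rewrite /affine_form mderivD mderivC addr0 raddf_sum; apply: eq_bigr => j _.
by rewrite [LHS]mderiv_mulC mderivXU.
Qed.

Lemma mderiv_affine_form_lshift i : affine_form^`M(lshift m i) = 0.
Proof.
by rewrite mderiv_affine_form big1 // => j _; rewrite eq_rlshift mulr0.
Qed.

Lemma mderiv_affine_form_rshift i : affine_form^`M(rshift n i) = (a i)%:MP.
Proof.
rewrite mderiv_affine_form (bigD1 i) //= eqxx mulr1 big1 ?addr0 // => j.
by rewrite (inj_eq (@rshift_inj _ _)) => /negPf->; rewrite mulr0.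
Qed.

Lemma meval_affine_form (x : 'cV[C]_n) :
  affine_form.@[fun i => col_mx x (0 : 'cV_m) i 0] = c.
Proof.
rewrite /affine_form mevalD mevalC raddf_sum big1 ?add0r // => j _.
by rewrite [LHS]mevalM mevalXU col_mxEd mxE mulr0.
Qed.

End AffineForm.

Lemma augmented_top n kappa (f : 'cV[{mpoly C[n]}]_n)
    (V1 : 'M[C]_(n, n - kappa)) V2 lam2 i :
  augmented f V1 V2 lam2 (lshift n i) 0 = lift_poly (n - kappa) (f i 0).
Proof. by rewrite /augmented col_mxEu mxE. Qed.

Lemma augmented_bottom n kappa (f : 'cV[{mpoly C[n]}]_n)
    (V1 : 'M[C]_(n, n - kappa)) V2 lam2 i :
  augmented f V1 V2 lam2 (rshift n i) 0 =
  \sum_k lift_poly (n - kappa) (f i 0)^`M(k) *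
          affine_form n (V1 k) ((V2 *m lam2) k 0).
Proof.
rewrite /augmented col_mxEd mxE; apply: eq_bigr => k _.
congr (_ * _); first by rewrite !mxE.
rewrite mxE; congr (_ + _); last by rewrite mxE.
by rewrite mxE; apply: eq_bigr => j _; rewrite !mxE.
Qed.

Lemma Dg_block n kappa (f : 'cV[{mpoly C[n]}]_n) (xi : 'cV[C]_n)
    (V1 : 'M[C]_(n, n - kappa)) (V2 : 'M[C]_(n, kappa)) (lam2 : 'cV[C]_kappa) :
  Dg f xi V1 V2 lam2 =
  block_mx (jacobian_at f xi) 0
           (hessian_mx f xi (V2 *m lam2)) (jacobian_at f xi *m V1).
Proof.
apply/matrixP=> a b; rewrite /Dg jacobian_atE.
case: (split_ordP a) => i ->.
  rewrite augmented_top; case: (split_ordP b) => j ->.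
    by rewrite block_mxEul jacobian_atE mderiv_lift_lshift meval_lift.
  by rewrite block_mxEur mxE mderiv_lift_rshift meval0.
rewrite augmented_bottom [X in meval _ X]raddf_sum [LHS]raddf_sum /=.
case: (split_ordP b) => j ->.
  rewrite block_mxEdl [RHS]mxE [RHS]mxE; apply: eq_bigr => k _.
  rewrite [X in X.@[_]]mderivM mevalD !mevalM mderiv_affine_form_lshift meval0.
  rewrite mulr0 addr0 meval_affine_form mderiv_lift_lshift meval_lift.
  rewrite (bigD1 j) //= big1 => [|l /negPf lj]; last first.
    by rewrite [delta_mx _ _ _ _]mxE lj mulr0.
  by rewrite [delta_mx _ _ _ _]mxE !eqxx mulr1 addr0.
rewrite block_mxEdr mxE; apply: eq_bigr => k _.
rewrite [X in X.@[_]]mderivM mevalD !mevalM mderiv_affine_form_rshift mevalC.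
by rewrite mderiv_lift_rshift meval0 mul0r add0r meval_lift jacobian_atE.
Qed.

End Deflation.

(** * The deflation criterion *)

Theorem theorem4 (R : realType) (n kappa : nat)
    (f : 'cV[{mpoly R[i][n]}]_n) (xi : 'cV[R[i]]_n)
    (hxi : isolated_singular_zero f xi)
    (hkappa : \dim (ker_mx (jacobian_at f xi)) = kappa)
    (hkn : (kappa <= n)%N)
    (V : 'M[R[i]]_n) (V1 : 'M[R[i]]_(n, n - kappa)) (V2 : 'M[R[i]]_(n, kappa))
    (hV : V = castmx (erefl n, subnK hkn) (row_mx V1 V2))
    (hVunit : V \in unitmx)
    (hV1 : forall w : 'cV[R[i]]_n, w \in im_mx V1 <->
             (forall z, z \in ker_mx (jacobian_at f xi) -> hdot w z = 0))
    (hV2 : im_mx V2 = ker_mx (jacobian_at f xi)) :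
  (forall lam2 : 'cV[R[i]]_kappa,
     Dg f xi V1 V2 lam2 =
     block_mx (jacobian_at f xi) 0
              (hessian_mx f xi (V2 *m lam2)) (jacobian_at f xi *m V1)) /\
  (deflation_one f xi V1 V2 <->
   almost_all (ker_mx (jacobian_at f xi)) (fun v => bijective (opA f xi v))).

Proof.
split=> [lam2|]; first exact: Dg_block.
(* The last rows [B2] of a left inverse [B] of [[V1, V2]] form a left inverse
   of [V2], hence the inverse on [ker J] of [V2] as a map onto [ker J]. *)
have /row_fullP[B BV] : row_full (row_mx V1 V2).
  by move: hVunit; rewrite -row_full_unit hV row_full_castmx_cols.
move: BV; rewrite -[B]vsubmxK mul_col_row scalar_mx_block.
case/eq_block_mx=> B1V1 _ _ B2V2.
set B2 := dsubmx B in B2V2; set J := jacobian_at f xi in hV1 hV2 *.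
have injV1 : full_column_rank V1.
  by apply/eqP/row_fullP; exists (usubmx B).
have V2J lam : V2 *m lam \in ker_mx J.
  by rewrite -hV2; apply/mem_im_mxP; exists lam.
have V2K v : v \in ker_mx J -> V2 *m (B2 *m v) = v.
  by rewrite -hV2 => /mem_im_mxP[lam ->]; rewrite (mulmxA B2) B2V2 mul1mx.
have regE lam2 : full_column_rank (Dg f xi V1 V2 lam2) <->
                 bijective (opA f xi (V2 *m lam2)).
  rewrite Dg_block block_full_column_rank // -bijective_mulmxP.
  have AE : opA f xi (V2 *m lam2) =1
      mulmx (J + hessian_mx f xi (V2 *m lam2) *m proj_ker J).
    by move=> w; rewrite /opA hessian_mxE mulmxDl mulmxA.
  by split=> /eq_bij; apply=> w; rewrite AE.
split=> [[_]|aaA]; last split=> //.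
  apply: (almost_all_pullback (A := B2) (A' := V2)) => [v _|lam _|lam _|v vJ].
  - exact: memvf.
  - exact: V2J.
  - by rewrite mulmxA B2V2 mul1mx.
  - by rewrite regE V2K.
apply: (almost_all_pullback (A := V2) (A' := B2)) aaA => [lam _|v _|v|lam _].
- exact: V2J.
- exact: memvf.
- exact: V2K.
- by rewrite regE.
Qed.
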